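(* Let $A\in\mathbb{B}(\mathscr{H})$ and let $C\in\mathbb{B}(\mathscr{H})$ be a generalized projection. Then $B\in\mathbb{B}(\mathscr{H})$ is a common $*$-lower bound of $A$ and $CC^*$ (that is, $B\stackrel{*}{\leq}A$ and $B\stackrel{*}{\leq}CC^*$) if and only if $B$ is an idempotent and there exist $X,Y\in\mathbb{B}(\mathscr{H})$ such that $$A=B+(I-B^* )X(I-B^* )\quad\text{and}\quad CC^*=B+Y,$$ where $B^*Y=YB^*=0$.
   Context: $\mathscr{H}$ is a complex Hilbert space, $\mathbb{B}(\mathscr{H})$ is the space of bounded linear operators on $\mathscr{H}$, and $I$ is the identity operator. An operator $C\in\mathbb{B}(\mathscr{H})$ is a generalized projection if $C^2=C^*$; an idempotent is an operator $B$ with $B^2=B$ (not necessarily self-adjoint). For $C,D\in\mathbb{B}(\mathscr{H})$, the $*$-order $C\stackrel{*}{\leq}D$ means $CC^*=DC^*$ and $C^*C=C^*D$. *)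

(* Defs.v *)
From HB Require Import structures.
From mathcomp Require Import all_boot all_order all_algebra.
From mathcomp Require Import sesquilinear.
From mathcomp Require Import complex.
From mathcomp Require Import boolp classical_sets reals interval_inference.
From mathcomp Require Import topology.
From mathcomp Require Import normedtype sequences.
From mathcomp Require Import ring lra.

Set Implicit Arguments.
Unset Strict Implicit.
Unset Printing Implicit Defensive.

Import Order.TTheory GRing.Theory Num.Theory.
Import numFieldNormedType.Exports.

Local Open Scope ring_scope.
Local Open Scope complex_scope.
Local Open Scope classical_set_scope.

(* The inner product is linear in its first argument and conjugate-linear in
   the second. *)
HB.mixin Record CompleteNormedModule_isHilbert (R : realType) H
    of CompleteNormedModule R[i] H := {
  inner : {dot H for (@Num.conj R[i])} ;
  sqr_norm_inner : forall x : H, `|x| ^+ 2 = inner x x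
}.

#[short(type="hilbertType")]
HB.structure Definition Hilbert (R : realType) :=
  {H of CompleteNormedModule R[i] H & CompleteNormedModule_isHilbert R H}.

Section BoundedOperators.
Context {R : realType} (H : hilbertType R).

Definition bounded_op (f : H -> H) :=
  exists M : R, forall x : H, `|f x| <= M%:C * `|x|.

Record bop := Bop {
  bop_fun :> H -> H ;
  bop_linear : linear bop_fun ;
  bop_bounded : bounded_op bop_fun }.

HB.instance Definition _ (A : bop) :=
  GRing.isLinear.Build R[i] H H *:%R A (bop_linear A).
HB.instance Definition _ := gen_eqMixin bop.
HB.instance Definition _ := gen_choiceMixin bop.

Lemma bopP (A B : bop) : A =1 B -> A = B.
Proof.
case: A B => [f lf bf] [g lg bg] /= /funext fg; subst g.
by rewrite (Prop_irrelevance lf lg) (Prop_irrelevance bf bg).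
Qed.

Lemma bounded_opP (f : H -> H) :
  bounded_op f -> exists2 M : R, 0 <= M & forall x, `|f x| <= M%:C * `|x|.
Proof.
case=> M fM; exists `|M| => [//|x]; apply: le_trans (fM x) _.
by rewrite ler_wpM2r// lecR ler_norm.
Qed.

Lemma linear_bop0 : linear (fun _ : H => 0 : H).
Proof. by move=> a x y; rewrite scaler0 addr0. Qed.
Lemma bounded_bop0 : bounded_op (fun _ : H => 0 : H).
Proof. by exists 0 => x; rewrite normr0 mul0r. Qed.
Definition bop0 := Bop linear_bop0 bounded_bop0.

Lemma linear_bop1 : linear (@id H). Proof. by []. Qed.
Lemma bounded_bop1 : bounded_op (@id H).
Proof. by exists 1 => x; rewrite mul1r. Qed.
Definition bop1 := Bop linear_bop1 bounded_bop1.

Lemma linear_bopN (A : bop) : linear (fun x => - A x).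
Proof. by move=> a x y; rewrite linearP opprD scalerN. Qed.
Lemma bounded_bopN (A : bop) : bounded_op (fun x => - A x).
Proof. by case: (bop_bounded A) => M AM; exists M => x; rewrite normrN. Qed.
Definition bopN A := Bop (linear_bopN A) (bounded_bopN A).

Lemma linear_bopD (A B : bop) : linear (fun x => A x + B x).
Proof. by move=> a x y; rewrite !linearP scalerDr addrACA. Qed.
Lemma bounded_bopD (A B : bop) : bounded_op (fun x => A x + B x).
Proof.
case: (bop_bounded A) (bop_bounded B) => M AM [N BN]; exists (M + N) => x.
by rewrite rmorphD mulrDl (le_trans (ler_normD _ _))// lerD.
Qed.
Definition bopD A B := Bop (linear_bopD A B) (bounded_bopD A B).

Lemma linear_bopM (A B : bop) : linear (A \o B).
Proof. by move=> a x y; rewrite /= !linearP. Qed.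
Lemma bounded_bopM (A B : bop) : bounded_op (A \o B).
Proof.
case: (bounded_opP (bop_bounded A)) => M M0 AM.
case: (bop_bounded B) => N BN; exists (M * N) => x /=.
apply: le_trans (AM _) _.
by rewrite rmorphM -mulrA ler_wpM2l// ler0c.
Qed.
Definition bopM A B := Bop (linear_bopM A B) (bounded_bopM A B).

Lemma bopDA : associative bopD.
Proof. by move=> A B C; apply: bopP => x /=; rewrite addrA. Qed.
Lemma bopDC : commutative bopD.
Proof. by move=> A B; apply: bopP => x /=; rewrite addrC. Qed.
Lemma bop0D : left_id bop0 bopD.
Proof. by move=> A; apply: bopP => x /=; rewrite add0r. Qed.
Lemma bopND : left_inverse bop0 bopN bopD.
Proof. by move=> A; apply: bopP => x /=; rewrite addNr. Qed.
HB.instance Definition _ := GRing.isZmodule.Build bop bopDA bopDC bop0D bopND.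

Lemma bopMA : associative bopM.
Proof. by move=> A B C; apply: bopP. Qed.
Lemma bop1M : left_id bop1 bopM.
Proof. by move=> A; apply: bopP. Qed.
Lemma bopM1 : right_id bop1 bopM.
Proof. by move=> A; apply: bopP. Qed.
Lemma bopMDl : left_distributive bopM +%R.
Proof. by move=> A B C; apply: bopP. Qed.
Lemma bopMDr : right_distributive bopM +%R.
Proof. by move=> A B C; apply: bopP => x /=; rewrite linearD. Qed.
HB.instance Definition _ :=
  GRing.Zmodule_isPzRing.Build bop bopMA bop1M bopM1 bopMDl bopMDr.

End BoundedOperators.

Notation "''B' ( H )" := (bop H) (format "''B' ( H )") : type_scope.

Section Adjoint.
Context {R : realType} (H : hilbertType R).
Implicit Types (x y z : H) (t : R).
Local Notation re z := (complex.Re z).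
Local Notation N x := (re (inner x x)).

Lemma innerC x y : inner x y = (inner y x)^*.
Proof. by rewrite hermC expr0 mul1r. Qed.
Lemma innerDl x y z : inner (x + y) z = inner x z + inner y z.
Proof. exact: linearDl. Qed.
Lemma innerZl (a : R[i]) x z : inner (a *: x) z = a * inner x z.
Proof. exact: linearZl_LR. Qed.
Lemma innerDr x y z : inner z (x + y) = inner z x + inner z y.
Proof. exact: linearDr. Qed.
Lemma innerZr (a : R[i]) x z : inner z (a *: x) = a^* * inner z x.
Proof. exact: linearZr. Qed.

Local Lemma reD (a b : R[i]) : re (a + b) = re a + re b.
Proof. by case: a b => [? ?] [? ?]. Qed.
Local Lemma reN (a : R[i]) : re (- a) = - re a. Proof. by case: a. Qed.
Local Lemma reZ t (a : R[i]) : re (t%:C * a) = t * re a.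
Proof. by case: a => a b /=; rewrite mul0r subr0. Qed.
Local Lemma re_conj (a : R[i]) : re a^* = re a. Proof. by case: a. Qed.

Lemma rinnerC x y : re (inner x y) = re (inner y x).
Proof. by rewrite innerC re_conj. Qed.
Lemma rinnerZr t x y : re (inner x (t%:C *: y)) = t * re (inner x y).
Proof. by rewrite rinnerC innerZl reZ rinnerC. Qed.

Local Lemma normE x : `|x| ^+ 2 = (N x)%:C.
Proof.
rewrite sqr_norm_inner [LHS]complexE.
suff -> : complex.Im (inner x x) = 0 by rewrite mulr0 addr0.
by have := innerC x x; case: (inner x x) => a b [] /=; lra.
Qed.

Local Lemma N_ge0 x : 0 <= N x.
Proof. by rewrite -ler0c -normE exprn_ge0. Qed.

Local Lemma N0_eq0 x : N x = 0 -> x = 0.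
Proof.
by move=> Nx0; apply/eqP; rewrite -normr_eq0 -sqrf_eq0 normE Nx0.
Qed.

Local Lemma ND x y t :
  N (x + t%:C *: y) = N x + 2 * t * re (inner x y) + t ^+ 2 * N y.
Proof.
rewrite innerDl !innerDr !reD rinnerZr innerZl reZ rinnerZr.
by rewrite innerZl reZ (rinnerC y x); ring.
Qed.

Lemma inner_inj y z : (forall x, re (inner x y) = re (inner x z)) -> y = z.
Proof.
move=> yz; apply/eqP; rewrite -subr_eq0; apply/eqP/N0_eq0.
by rewrite (innerDr y) reD yz -[- z]scaleN1r innerZr rmorphN1 mulN1r reN subrr.
Qed.

Local Lemma boundedN (f : H -> H) : bounded_op f <->
  exists2 M : R, 0 <= M & forall x, N (f x) <= M * N x.
Proof.
split=> [/bounded_opP[M M0 fM]|[M M0 fM]].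
  exists (M ^+ 2) => [|x]; first exact: exprn_ge0.
  rewrite -lecR; have -> : (M ^+ 2 * N x)%:C = (M%:C * `|x|) ^+ 2.
    by rewrite exprMn normE -rmorphXn -rmorphM.
  by rewrite -normE ler_pXn2r// nnegrE// mulr_ge0// ler0c.
exists (Num.sqrt M) => x.
rewrite -(@ler_pXn2r _ 2)// ?nnegrE// ?mulr_ge0 ?ler0c ?sqrtr_ge0//.
by rewrite exprMn -rmorphXn sqr_sqrtr// !normE -rmorphM lecR.
Qed.

(* f is represented by the minimizer of |x|^2 - 2 Re (f x) over H. *)
Section Riesz.
Variables (f : H -> R[i]) (K : R).
Hypothesis fD : forall x y, f (x + y) = f x + f y.
Hypothesis fZ : forall a x, f (a *: x) = a * f x.
Hypothesis fK : forall x, 2 * re (f x) <= N x + K.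

Let J x := N x - 2 * re (f x).

Let JD x y t : J (x + t%:C *: y) =
  J x + 2 * t * (re (inner y x) - re (f y)) + t ^+ 2 * N y.
Proof. by rewrite /J ND fD fZ reD reZ (rinnerC x y); ring. Qed.

Let infJ := inf (range J).

Let infJP : has_inf (range J).
Proof.
split; first by exists (J 0), 0.
by exists (- K) => _ [x _ <-]; rewrite /J; have := fK x; lra.
Qed.

Let infJ_le x : infJ <= J x.
Proof. by apply: ge_inf; [exact: infJP.2|exists x]. Qed.

Let xn_ex n : exists x, J x < infJ + n.+1%:R^-1.
Proof.
have n0 : 0 < (n.+1%:R^-1 : R) by rewrite invr_gt0.
by have [_ [x _ <-] ?] := inf_adherent n0 infJP; exists x.
Qed.

Let xn n : H := projT1 (cid (xn_ex n)).
Let xnP n : J (xn n) < infJ + n.+1%:R^-1 := projT2 (cid (xn_ex n)).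

Let N_xn n m : N (xn n - xn m) <= 2 * (n.+1%:R^-1 + m.+1%:R^-1).
Proof.
set d := xn n - xn m.
have e1 : xn n = xn m + 1%:C *: d by rewrite scale1r /d addrC subrK.
have h1 := JD (xn m) d 1; rewrite -e1 in h1.
have h2 := JD (xn m) d (2^-1).
have h3 := infJ_le (xn m + (2^-1)%:C *: d).
have h4 := xnP n; have h5 := xnP m.
rewrite expr1n mulr1 mul1r in h1.
rewrite mulfV ?pnatr_eq0// mul1r in h2.
have h6 : (2^-1 : R) ^+ 2 = 1 / 4 by field.
rewrite h6 in h2; rewrite -/infJ in h3 *.
move: (J (xn n)) (J (xn m)) (J _) (re _ - re _) (N d) infJ
  n.+1%:R^-1 m.+1%:R^-1 h1 h2 h3 h4 h5.
clear; move=> a b c e Nd i u v *; lra.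
Qed.

Local Lemma inv_small (e : R) (e0 : 0 < e) :
  \forall n \near \oo, n.+1%:R^-1 < e.
Proof.
by have := near_infty_natSinv_lt (PosNum e0).
Qed.

Local Lemma norm_lt x (e : R) : 0 < e -> N x < e ^+ 2 -> `|x| < e%:C.
Proof.
move=> e0 Nxe; rewrite -(@ltr_pXn2r _ 2)// ?nnegrE ?ler0c ?(ltW e0)//.
by rewrite normE -rmorphXn ltcR.
Qed.

Local Lemma posC (e : R[i]) : 0 < e -> exists2 r : R, 0 < r & e = r%:C.
Proof.
case: e => a b; rewrite ltcE /= => /andP[/eqP -> a0].
by exists a.
Qed.

Let xn_cvg : cvg (xn @ \oo).
Proof.
apply: cauchy_cvg; apply/cauchyP => _ /posC[e e0 ->].
have e4 : 0 < e ^+ 2 / 4 by rewrite divr_gt0// exprn_gt0.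
have [k _ /(_ _ _)kP] := inv_small e4.
exists (xn k); exists k => // n /= kn.
rewrite -ball_normE /=; apply: norm_lt => //.
apply: le_lt_trans (N_xn _ _) _.
have /= := kP k (leqnn k); have /= := kP n kn.
by move: n.+1%:R^-1 k.+1%:R^-1 (e ^+ 2) => u v w; lra.
Qed.

Lemma riesz : exists y, forall x, f x = inner x y.
Proof.
pose l : H := lim (xn @ \oo).
have re_riesz y : re (inner y l) = re (f y).
  pose c := re (inner y l) - re (f y).
  have key t : 0 <= 2 * t * c + 2 * t ^+ 2 * N y.
    apply/ler_addgt0Pl => e e0.
    have e2 : 0 < e / 2 by lra.
    pose s := Num.sqrt (e / 2).
    have s0 : 0 < s by rewrite sqrtr_gt0.
    have /cvgrPdist_lt/(_ s%:C) : xn @ \oo --> l := xn_cvg.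
    rewrite ltcR => /(_ s0) h.
    near \oo => n.
    have h1 : n.+1%:R^-1 < e / 2 by near: n; exact: inv_small.
    have h2 : N (l - xn n) < e / 2.
      have : `|l - xn n| < s%:C by near: n; exact: h.
      rewrite -(@ltr_pXn2r _ 2)// ?nnegrE ?ler0c ?(ltW s0)//.
      by rewrite normE -rmorphXn ltcR sqr_sqrtr// ltW.
    have h3 := infJ_le (xn n + t%:C *: y); rewrite JD in h3.
    have h4 := xnP n.
    have h5 := N_ge0 ((l - xn n) + t%:C *: y); rewrite ND in h5.
    have h6 : re (inner (l - xn n) y) = re (inner y l) - re (inner y (xn n)).
      rewrite rinnerC innerDr reD; congr (_ + _).
      by rewrite -[- xn n]scaleN1r innerZr rmorphN1 mulN1r reN.
    rewrite h6 in h5; rewrite /c.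
    move: (J _) (N (l - _)) (N y) infJ n.+1%:R^-1 (re (inner y l)) (re (f y))
      (re (inner y (xn n))) h1 h2 h3 h4 h5.
    by clear=> a b d i u v w z *; lra.
  suff : c = 0 by rewrite /c; lra.
  have [Ny0|Ny0] := eqVneq (N y) 0.
    by have := key 1; have := key (-1); rewrite Ny0; lra.
  have Ny : 0 < N y by rewrite lt_neqAle eq_sym Ny0 N_ge0.
  have := key (- c / (2 * N y)).
  have -> : 2 * (- c / (2 * N y)) * c + 2 * (- c / (2 * N y)) ^+ 2 * N y =
     - (c ^+ 2 / (2 * N y)) by field.
  rewrite oppr_ge0 pmulr_lle0 ?invr_gt0 ?mulr_gt0//.
  by move=> c2; apply/eqP; rewrite -sqrf_eq0 eq_le c2 sqr_ge0.
exists l => x; apply/eqP; rewrite eq_complex re_riesz eqxx /=.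
have := re_riesz ('i *: x); rewrite innerZl fZ.
by case: (f x) (inner x l) => [a b] [c d] /=; lra.
Unshelve. all: by end_near. Qed.

End Riesz.

Lemma adj_ex (A : 'B(H)) :
  exists B : 'B(H), forall x y, inner (A x) y = inner x (B y).
Proof.
have [M M0 AM] := (boundedN A).1 (bop_bounded A).
have bnd x y : 2 * re (inner (A x) y) <= N x + (M + 1) * N y.
  have M1 : 0 < M + 1 by lra.
  have := N_ge0 (A x + (- (M + 1))%:C *: y); rewrite ND => h.
  rewrite -(ler_pM2l M1).
  have := AM x; have := N_ge0 x; nra.
have /choice[g gP] : forall y, exists z, forall x, inner (A x) y = inner x z.
  move=> y; apply: (@riesz (fun x => inner (A x) y) ((M + 1) * N y)) => //.
  - by move=> x z; rewrite linearD innerDl.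
  - by move=> a x; rewrite linearZ innerZl.
have lg : linear g.
  move=> a y z; apply: inner_inj => x.
  by rewrite -gP !innerDr !innerZr -!gP.
have bg : bounded_op g.
  apply/boundedN; exists (M + 1); first lra.
  by move=> y; have := bnd (g y) y; rewrite gP; lra.
by exists (Bop lg bg) => x y; rewrite /= gP.
Qed.

Definition adj (A : 'B(H)) : 'B(H) := projT1 (cid (adj_ex A)).

Lemma adjP (A : 'B(H)) x y : inner (A x) y = inner x (adj A y).
Proof. by rewrite /adj; case: cid. Qed.

Definition generalized_projection (C : 'B(H)) := C ^+ 2 = adj C.

Definition idempotent_bop (B : 'B(H)) := B ^+ 2 = B.

Definition star_le (C D : 'B(H)) :=
  C * adj C = D * adj C /\ adj C * C = adj C * D.

End Adjoint.

(* Main.v *)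
Require Import Defs.
From mathcomp Require Import all_boot all_algebra.
From mathcomp Require Import reals.

(** The adjoint makes the bounded operators a proper *-ring: [adj] is an
    involutive anti-automorphism and [adj T * T = 0] forces [T = 0]. Everything
    else is algebra in that ring.

    Since [C ^+ 2 = adj C], one gets [C * adj C = C ^+ 3] and [C ^+ 4 = C], so
    [P := C * adj C] is an orthogonal projection. The heart of the matter is
    that an operator [B] below an orthogonal projection [P] in the *-order is
    itself an orthogonal projection ([star_le_proj]). Once [B] is known to be
    self-adjoint and idempotent, [star_le B A] says [A * B = B = B * A], which
    is the block decomposition of [A] with [X := A], and [star_le B P] says
    that [Y := P - B] is annihilated by [B] on both sides. Conversely the two
    decompositions give back the *-order relations by direct expansion, using
    only that [adj B] is idempotent. *)

Local Open Scope ring_scope.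

Import GRing.Theory Num.Theory.

Section Involution.
Context {R : realType} {H : hilbertType R}.
Implicit Types B C P S T : 'B(H).

(** Adjoints are computed by exhibiting an operator that satisfies the defining
    identity. *)
Lemma adj_unique T S :
  (forall x y, inner (T x) y = inner x (S y)) -> adj T = S.
Proof.
move=> TS; apply: bopP => y; apply: inner_inj => x.
by rewrite -adjP TS.
Qed.

Lemma adjK T : adj (adj T) = T.
Proof. by apply: adj_unique => x y; rewrite innerC -adjP -innerC. Qed.

Lemma adjM S T : adj (S * T) = adj T * adj S.
Proof. by apply: adj_unique => x y; rewrite /= !adjP. Qed.

(** Positive definiteness: [|T x| ^+ 2] is the inner product of [x] and
    [adj T (T x)]. *)
Lemma adj_mul_eq0 T : adj T * T = 0 -> T = 0.
Proof.
move=> TT0; apply: bopP => x; apply/eqP.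
rewrite -normr_eq0 -sqrf_eq0 sqr_norm_inner adjP.
have -> : adj T (T x) = (adj T * T) x by [].
by rewrite TT0 /= linear0.
Qed.

Lemma mul_adj_eq0 T : T * adj T = 0 -> T = 0.
Proof.
move=> TT0; have /adj_mul_eq0 T0 : adj (adj T) * adj T = 0 by rewrite adjK.
by rewrite -[T]adjK T0; apply: adj_unique => x y; rewrite /= linear0l linear0r.
Qed.

(** [S * adj B] times its own adjoint begins with [S * adj B * B]. *)
Lemma mul_adj_cancel S B : S * adj B * B = 0 -> S * adj B = 0.
Proof.
by move=> SB0; apply: mul_adj_eq0; rewrite adjM adjK mulrA SB0 mul0r.
Qed.

Lemma generalized_projection_proj C : generalized_projection C ->
  adj (C * adj C) = C * adj C /\ idempotent_bop (C * adj C).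
Proof.
move=> hC; split; first by rewrite adjM adjK.
have C4 : C ^+ 4 = C by rewrite (exprM C 2 2) hC expr2 -adjM -expr2 hC adjK.
rewrite /idempotent_bop -hC -exprS -exprM.
(* [C ^+ 6 = C ^+ 4 * C ^+ 2 = C * C ^+ 2] *)
by rewrite (exprD C 4 2) C4 -exprS.
Qed.

(** The product [B * adj B * B] collapses to [adj B * B], because
    [B * adj B = P * adj B] and [adj B * B = P * B], and [P] absorbs itself.
    Cancelling the last factor leaves [B * adj B = adj B]; the left-hand side is
    self-adjoint, hence so is [B], and the equation then reads [B * B = B]. *)
Lemma star_le_proj B P : adj P = P -> idempotent_bop P -> star_le B P ->
  adj B = B /\ idempotent_bop B.
Proof.
rewrite /idempotent_bop expr2 => Psa PP [BPl BPr].
have BPr' : adj B * B = P * B.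
  by rewrite -{1}Psa -[B in RHS]adjK -adjM -BPr adjM adjK.
have BBB : B * adj B * B = adj B * B by rewrite BPl -mulrA BPr' mulrA PP.
have /mul_adj_cancel/eqP : (B - 1) * adj B * B = 0.
  by rewrite !mulrBl mul1r BBB subrr.
rewrite mulrBl mul1r subr_eq0 => /eqP BB.
have Bsa : adj B = B by rewrite -[RHS]adjK -BB adjM adjK.
by split; rewrite // expr2; move: BB; rewrite Bsa.
Qed.

End Involution.

Theorem proposition4p9 (R : realType) (H : hilbertType R) (A C : 'B(H))
    (hC : generalized_projection C) (B : 'B(H)) :
  (star_le B A /\ star_le B (C * adj C)) <->
  (idempotent_bop B /\
   exists X Y : 'B(H),
     [/\ A = B + (1 - adj B) * X * (1 - adj B),
         C * adj C = B + Y,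
         adj B * Y = 0 & Y * adj B = 0]).
Proof.
have [Psa PP] := generalized_projection_proj _ hC.
move: (C * adj C) Psa PP => P Psa PP; split.
  move=> [[BAl BAr] BP]; have [Bsa BB] := star_le_proj _ _ Psa PP BP.
  split=> //; case: BP => BPl BPr; exists A, (P - B).
  move: BAl BAr BPl BPr BB; rewrite /idempotent_bop expr2 !Bsa.
  move=> BAl BAr BPl BPr BB; rewrite BB in BAl BAr BPl BPr.
  split.
  - rewrite !mulrBr !mulrBl !mulr1 !mul1r -BAl -BAr BB subrr subr0.
    by rewrite addrC subrK.
  - by rewrite addrC subrK.
  - by rewrite mulrBr -BPr BB subrr.
  - by rewrite mulrBl -BPl BB subrr.
rewrite /idempotent_bop expr2.
move=> [BB [X [Y [-> -> BY YB]]]].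
have BB' : adj B * adj B = adj B by rewrite -adjM BB.
split; split.
- rewrite mulrDl -(mulrA _ _ (adj B)) (mulrBl (adj B)) mul1r.
  by rewrite BB' subrr mulr0 addr0.
- by rewrite mulrDr !mulrA (mulrBr (adj B) 1) mulr1 BB' subrr !mul0r addr0.
- by rewrite mulrDl YB addr0.
- by rewrite mulrDr BY addr0.
Qed.
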